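(* For any $d\ge 3$ and $\delta>0$, there exist constants $0<U_0(d,\delta)<1$ and $C_1(d,\delta)>0$ such that for any $0<u\le U_0$, $$T_c^-(u,d)\ge C_1\,u^{-\frac{1}{d-1}+\delta}.$$
   Context: $\mathbb{L}^d=\{\{x,y\}: x,y\in\mathbb{Z}^d,\ |x-y|_2=1\}$ is the set of undirected nearest-neighbor edges of $\mathbb{Z}^d$ ($|\cdot|_2$ is the Euclidean norm). For $T\in(0,\infty)$ and $x\in\mathbb{Z}^d$, $P_x^{(T)}$ is the law of the simple random walk on $\mathbb{Z}^d$ started at $x$ and killed with probability $\frac1{T+1}$ at each step: the number of steps $N$ (the length of the path) satisfies $P(N=k)=\left(\frac{T}{T+1}\right)^k\frac{1}{T+1}$ for $k=0,1,2,\dots$ (mean $T$) and is independent of the underlying simple random walk. $P_x^{(T)}$ is regarded as a measure on the set $W^{[0,\infty)}$ of finite nearest-neighbor paths in $\mathbb{Z}^d$. For $0<u,T<\infty$, the finitary random interlacement $\mathcal{FI}^{u,T}$ is the Poisson point process on $W^{[0,\infty)}$ with intensity measure $u\sum_{x\in\mathbb{Z}^d}\frac{2d}{T+1}P_x^{(T)}$. Equivalently, with $\{N_x\}_{x\in\mathbb{Z}^d}$ i.i.d. Poisson of parameter $\frac{2du}{T+1}$, one starts $N_x$ independent killed walks of law $P_x^{(T)}$ from each $x\in\mathbb{Z}^d$, and $\mathcal{FI}^{u,T}$ is the point measure consisting of all these trajectories. It is also regarded as a bond percolation model: an edge $e\in\mathbb{L}^d$ is open iff some path in $\mathcal{FI}^{u,T}$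 traverses $e$. $\mathcal{FI}^{u,T}$ percolates iff there is an infinite connected cluster composed of open edges. Critical value, for $u>0$ and $d\ge3$: $T_c^-(u,d)=\sup\{T_0>0:\ \forall\, 0<T<T_0,\ \mathcal{FI}^{u,T}\text{ a.s. does not percolate}\}$. *)

(* Defs.v *)
From HB Require Import structures.
From Stdlib Require Import Relation_Operators.
From mathcomp Require Import all_boot all_order all_algebra.
From mathcomp Require Import all_classical all_reals all_analysis.
From mathcomp Require Import measurable_realfun.

Set Implicit Arguments.
Unset Strict Implicit.
Unset Printing Implicit Defensive.

Import Order.TTheory GRing.Theory Num.Theory.
Import numFieldNormedType.Exports.

Local Open Scope classical_set_scope.
Local Open Scope ring_scope.

Notation Zd d := 'rV[int]_d.

Section lattice.
Variable d : nat.

(* |x - y|_2 = 1, expressed in Z through |x - y|_2 ^ 2 = 1; see [nbrE]. *)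
Definition nbr (x y : Zd d) : bool := \sum_(i < d) (x 0 i - y 0 i) ^+ 2 == 1.

Definition eucl_norm (R : realType) (x : Zd d) : R :=
  Num.sqrt (\sum_(i < d) (x 0 i)%:~R ^+ 2).

Lemma nbrE (R : realType) (x y : Zd d) : nbr x y = (eucl_norm R (x - y) == 1).
Proof.
pose s := \sum_(i < d) (x 0 i - y 0 i) ^+ 2.
have -> : eucl_norm R (x - y) = Num.sqrt s%:~R.
  rewrite /eucl_norm /s rmorph_sum /=; congr Num.sqrt.
  by apply: eq_bigr => i _; rewrite rmorphXn /= !mxE.
have s0 : (0 : R) <= s%:~R by rewrite ler0z sumr_ge0// => i _; exact: sqr_ge0.
rewrite /nbr -/s -(eqr_int R); apply/eqP/eqP => [->|s1].
  by rewrite rmorph1 sqrtr1.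
by rewrite -(sqr_sqrtr s0) s1 expr1n.
Qed.

(* Undirected edges are two-point sets. *)
Definition lattice_edges : set (set (Zd d)) :=
  [set e | exists x y : Zd d, nbr x y /\ e = [set x; y]].

(* The finite path (x_0, ..., x_k) is stored as (x_0, [:: x_1; ...; x_k]). *)
Record fpath := FPath {
  fpath_val :> Zd d * seq (Zd d) ;
  fpath_nbr : path nbr fpath_val.1 fpath_val.2 }.

HB.instance Definition _ := [isSub for fpath_val].
HB.instance Definition _ := [Countable of fpath by <:].
HB.instance Definition _ := isPointed.Build fpath (@FPath (0, [::]) isT).

(* W^[0,oo) is countable and carries the discrete sigma-algebra. *)
HB.instance Definition _ := @isMeasurable.Build default_measure_display fpath
  discrete_measurable discrete_measurable0
  discrete_measurableC discrete_measurableU.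

Definition path_start (w : fpath) : Zd d := w.1.
Definition path_length (w : fpath) : nat := size w.2.
Definition path_site (w : fpath) (i : nat) : Zd d := nth 0 (w.1 :: w.2) i.

Definition traverses (w : fpath) (e : set (Zd d)) : Prop :=
  exists2 i, (i < path_length w)%N & e = [set path_site w i; path_site w i.+1].

End lattice.

Section killed_walk.
Context {R : realType} (d : nat).

Definition srw_kernel (x y : Zd d) : R := if nbr x y then (2 * d%:R)^-1 else 0.

Definition killed_length_pmf (T : R) (k : nat) : R :=
  (T / (T + 1)) ^+ k * (T + 1)^-1.

Definition killed_srw_pmf (T : R) (x : Zd d) (w : fpath d) : R :=
  if path_start w == x then
    killed_length_pmf T (path_length w) *
    \prod_(i < path_length w) srw_kernel (path_site w i) (path_site w i.+1)
  else 0.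

Definition killed_srw (T : R) (x : Zd d) (A : set (fpath d)) : \bar R :=
  (\esum_(w in A) (killed_srw_pmf T x w)%:E)%E.

End killed_walk.

Section poisson_point_process.
Context {R : realType}.

Definition mutually_independent d (Omega : measurableType d)
    (P : probability Omega R) (n : nat) (X : 'I_n -> Omega -> \bar R) : Prop :=
  forall B : 'I_n -> set (\bar R), (forall i, measurable (B i)) ->
    P (\bigcap_(i in [set: 'I_n]) (X i @^-1` B i)) =
    (\prod_(i < n) P (X i @^-1` B i))%E.

(* The Poisson law is written out because the library's [poisson_pmf] is
   constantly 1 at rate 0; here 0 ^+ 0 = 1 gives the Dirac mass at 0. *)
Definition poisson_distributed d (Omega : measurableType d)
    (P : probability Omega R) (X : Omega -> \bar R) (lambda : \bar R) : Prop :=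
  match lambda with
  | r%:E%E => forall k : nat, P (X @^-1` [set k%:R%:E%E]) =
                (r ^+ k / k`!%:R * expR (- r))%:E%E
  | +oo%E => P (X @^-1` [set +oo%E]) = 1%E
  | -oo%E => False
  end.

Record poisson_point_process d (Omega : measurableType d)
    (P : probability Omega R) d' (W : measurableType d')
    (mu : set W -> \bar R) (N : Omega -> {measure set W -> \bar R}) : Prop := {
  ppp_measurable : forall A, measurable A ->
    measurable_fun [set: Omega] (fun omega => N omega A) ;
  ppp_integer : forall omega A, measurable A ->
    N omega A = +oo%E \/ exists k : nat, N omega A = k%:R%:E%E ;
  ppp_poisson : forall A, measurable A ->
    poisson_distributed P (fun omega => N omega A) (mu A) ;
  ppp_independent : forall (n : nat) (A : 'I_n -> set W),
    (forall i, measurable (A i)) -> trivIset [set: 'I_n] A ->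
    mutually_independent P (fun i omega => N omega (A i)) }.

End poisson_point_process.

Section finitary_interlacement.
Context {R : realType} (d : nat).

Definition fri_intensity (u T : R) (A : set (fpath d)) : \bar R :=
  (u%:E * \esum_(x in [set: Zd d])
            ((2 * d%:R / (T + 1))%:E * killed_srw T x A))%E.

Definition is_fri (u T : R) d' (Omega : measurableType d')
    (P : probability Omega R) (FI : Omega -> {measure set (fpath d) -> \bar R})
    : Prop := poisson_point_process P (fri_intensity u T) FI.

Definition open_edges (m : {measure set (fpath d) -> \bar R}) : set (set (Zd d)) :=
  [set e | lattice_edges e /\
           exists w : fpath d, (0 < m [set w])%E /\ traverses w e].

Definition cluster (m : {measure set (fpath d) -> \bar R}) (x : Zd d) : set (Zd d) :=
  [set y | clos_refl_trans (Zd d) (fun a b => open_edges m [set a; b]) x y].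

Definition percolates (m : {measure set (fpath d) -> \bar R}) : Prop :=
  exists x : Zd d, infinite_set (cluster m x).

(* Being an almost sure property, it depends only on the law of FI^{u,T}; it is
   required of every realization of that law. *)
Definition as_no_percolation (u T : R) : Prop :=
  forall (d' : measure_display) (Omega : measurableType d')
    (P : probability Omega R) (FI : Omega -> {measure set (fpath d) -> \bar R}),
    is_fri u T P FI -> {ae P, forall omega, ~ percolates (FI omega)}.

Definition Tc_minus (u : R) : \bar R :=
  ereal_sup [set T0%:E%E | T0 in [set T0 : R | 0 < T0 /\
    forall T : R, 0 < T -> T < T0 -> as_no_percolation u T]].

End finitary_interlacement.

(* Main.v *)
From Pilot Require Import Defs.
From HB Require Import structures.
From Stdlib Require Import Operators_Properties.
From mathcomp Require Import all_boot all_order all_algebra.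
From mathcomp Require Import all_classical all_reals all_analysis.
From mathcomp Require Import measurable_realfun.
From mathcomp Require Import ring lra.
(* [fpath] denotes the lattice paths, not the function paths of seq. *)
Import Pilot.Defs.

Import Order.TTheory GRing.Theory Num.Theory.
Local Open Scope ring_scope.

(** The bound holds with the larger power u^{-1}: the interlacement does not
    percolate as soon as beta := 2du(1 + 2T) < 1, and T <= u^{-1}/(16d) with
    u <= 1/(16d) is enough for that. As d >= 3, the exponent -1/(d-1) + delta
    is at least -1, so that u^{-1/(d-1) + delta} <= u^{-1} for u <= 1.

    The argument is the comparison with a subcritical branching process. Write
    mu(w) for the intensity of the trajectory w and |w| for its number of
    sites. For a fixed site y, the sum of |w| mu(w) over the trajectories
    w through y is at most beta ([sum_walk_rate_through]). Indeed, there are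
    (2d)^k paths of length k which are at y at time i <= k, each of weight
    (2d)^{-k}, so that the sum is at most (2du/(T+1)) E[(N+1)^2], where the
    length N is geometric of mean T and E[(N+1)^2] = (1+T)(1+2T).

    A chain from x is a sequence of trajectories w_1, ..., w_n such that w_1
    passes through x and each w_{i+1} meets w_i. Exploring the chains one
    trajectory at a time, the first-moment estimate above shows that the sum
    over all chains from x of the product of the intensities is at most
    1 + beta + beta^2 + ... = 1/(1 - beta) ([sum_chain_weight]). If
    the trajectories of a chain are pairwise distinct, then by independence all
    of them occur with probability at most the product of their intensities
    ([prob_all_open_le]). By the Borel-Cantelli lemma, almost surely only
    finitely many chains of distinct trajectories from x occur. Every point of
    the cluster of x is x itself or a site of the last trajectory of such a
    chain ([cluster_chain]), hence the cluster is finite, simultaneously for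
    all of the countably many x.

    All infinite sums are handled through their finite partial sums, indexed by
    duplicate-free sequences. *)

(** * Counting nearest-neighbour paths through a site *)

(** The list of the sites visited by a path, starting point included. *)
Definition sites {d : nat} (w : fpath d) : seq (Zd d) := w.1 :: w.2.

(** The 2d nearest neighbours of [x]. *)
Definition neighbours {d : nat} (x : Zd d) : seq (Zd d) :=
  [seq x + z *: delta_mx 0 i | z <- [:: 1; -1 : int], i <- enum 'I_d].

Lemma size_neighbours (d : nat) (x : Zd d) : size (neighbours x) = (2 * d)%N.
Proof. by rewrite size_allpairs /= size_enum_ord. Qed.

Lemma nbr_sym (d : nat) (x y : Zd d) : nbr x y = nbr y x.
Proof.
by rewrite /nbr; congr (_ == _); apply: eq_bigr => i _; rewrite -sqrrN opprB.
Qed.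

Lemma sqr_int_ge1 (z : int) : z != 0 -> 1 <= z ^+ 2.
Proof. by move=> z0; rewrite -gtz0_ge1 exprn_even_gt0. Qed.

Lemma sqr_int_eq0 (z : int) : z ^+ 2 <= 0 -> z = 0.
Proof.
move=> z2; apply/eqP; rewrite -sqrf_eq0 eq_le z2; exact: sqr_ge0.
Qed.

Lemma nbr_neighbours (d : nat) (x y : Zd d) : nbr x y -> y \in neighbours x.
Proof.
move=> /eqP s1.
have [i xyi] : exists i, x 0 i - y 0 i != 0.
  apply/existsP; apply: contraPT s1 => /existsPn xy.
  rewrite big1 // => i _; have := xy i.
  by rewrite negbK => /eqP ->; rewrite expr0n.
move: s1; rewrite (bigD1 i) //= => s1.
have t0 : 0 <= \sum_(j < d | j != i) (x 0 j - y 0 j) ^+ 2.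
  by apply: sumr_ge0 => j _; exact: sqr_ge0.
have i1 := sqr_int_ge1 _ xyi.
have yj j : j != i -> y 0 j = x 0 j.
  move=> ji; apply/esym/eqP; rewrite -subr_eq0; apply/eqP/sqr_int_eq0.
  move: s1; rewrite (bigD1 j) //= => s1.
  have : 0 <= \sum_(k < d | (k != i) && (k != j)) (x 0 k - y 0 k) ^+ 2.
    by apply: sumr_ge0 => k _; exact: sqr_ge0.
  by move: (sqr_ge0 (x 0 j - y 0 j)) => *; lra.
have : (x 0 i - y 0 i) ^+ 2 == 1 by apply/eqP; lra.
rewrite sqrf_eq1 => e.
apply/allpairsP; exists (y 0 i - x 0 i, i); split=> /=.
- by rewrite !inE; case/orP: e => /eqP e; apply/orP; [right|left];
    rewrite -opprB e ?opprK.
- by rewrite mem_enum.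
- apply/rowP => j; rewrite !mxE eqxx /=.
  have [->|ji] := eqVneq j i; first by rewrite mulr1 addrC subrK.
  by rewrite mulr0 addr0 yj.
Qed.

(** The nearest-neighbour paths of length [k] which are at [y] at time [i],
    each given as the list of its [k.+1] sites. The recursion removes the first
    site. The default [y] of [head] is not used, as no path is empty; for
    [k < i] the definition is meaningless. *)
Fixpoint paths_at {d : nat} (k i : nat) (y : Zd d) : seq (seq (Zd d)) :=
  match k, i with
  | 0%N, _ => [:: [:: y]]
  | k'.+1, 0%N => [seq y :: p | z <- neighbours y, p <- paths_at k' 0 z]
  | k'.+1, i'.+1 =>
      [seq x :: p | p <- paths_at k' i' y, x <- neighbours (head y p)]
  end.

Lemma size_paths_at (d k i : nat) (y : Zd d) :
  size (paths_at k i y) = ((2 * d) ^ k)%N.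
Proof.
elim: k i y => [|k IH] [|i] y //=; rewrite size_allpairs_dep.
- rewrite (eq_map (g := fun=> ((2 * d) ^ k)%N)); last by move=> z; exact: IH.
  by rewrite sumnE big_map big_const_seq count_predT iter_addn_0 size_neighbours
             mulnC expnS.
- rewrite (eq_map (g := fun=> (2 * d)%N)); last first.
    by move=> p; exact: size_neighbours.
  by rewrite sumnE big_map big_const_seq count_predT iter_addn_0 IH expnS.
Qed.

Lemma mem_paths_at (d i : nat) (x : Zd d) (s : seq (Zd d)) :
  path (@nbr d) x s -> (i <= size s)%N ->
  x :: s \in paths_at (size s) i (nth 0 (x :: s) i).
Proof.
elim: s x i => [|z s IH] x [|i] //=; rewrite ?inE //.
- move=> /andP[xz zs] _; apply/allpairsPdep; exists z, (z :: s).
  by split=> //; [exact: nbr_neighbours | exact: (IH z 0%N)].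
- move=> /andP[xz zs] iS; apply/allpairsPdep; exists (z :: s), x.
  by split=> //; [exact: IH | apply: nbr_neighbours; rewrite nbr_sym].
Qed.

Lemma sites_inj (d : nat) : injective (@sites d).
Proof.
move=> w w' e; apply: val_inj; case: w w' e => [[x s] /= p] [[x' s'] /= p'].
by rewrite /sites /= => -[-> ->].
Qed.

Lemma count_paths_at (d : nat) (X : seq (fpath d)) (k i : nat) (y : Zd d) :
  uniq X -> (i <= k)%N ->
  (count (fun w => (path_length w == k) && (path_site w i == y)) X
    <= (2 * d) ^ k)%N.
Proof.
move=> uX ik; rewrite -(size_paths_at d k i y) -size_filter.
rewrite -(size_map (@sites d)); apply: uniq_leq_size.
  by rewrite map_inj_uniq; [exact: filter_uniq | exact: sites_inj].
move=> p /mapP[w]; rewrite mem_filter => /andP[/andP[/eqP wk /eqP wi] _] ->.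
rewrite -wk -wi; apply: mem_paths_at; first exact: fpath_nbr.
by rewrite -[size _]/(path_length w) wk.
Qed.

(** * Intensity of the trajectories through a site *)

(** The intensity of the single trajectory [w] in FI^{u,T}; only the walks
    started at the first site of [w] contribute. *)
Definition walk_rate {R : realType} {d : nat} (u T : R) (w : fpath d) : R :=
  u * (2 * d%:R / (T + 1) * killed_srw_pmf T (path_start w) w).

Lemma killed_length_pmf_ge0 (R : realType) (T : R) (k : nat) :
  0 < T -> 0 <= killed_length_pmf T k.
Proof.
move=> T0; rewrite mulr_ge0 ?exprn_ge0 ?divr_ge0 ?invr_ge0 ?addr_ge0 //; exact: ltW.
Qed.

Lemma killed_srw_pmf_ge0 (R : realType) (d : nat) (T : R) (x : Zd d)
    (w : fpath d) : 0 < T -> 0 <= killed_srw_pmf T x w.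
Proof.
move=> T0; rewrite /killed_srw_pmf; case: ifP => // _.
apply: mulr_ge0; first exact: killed_length_pmf_ge0.
by apply: prodr_ge0 => i _; rewrite /srw_kernel; case: ifP.
Qed.

Lemma walk_rate_ge0 (R : realType) (d : nat) (u T : R) (w : fpath d) :
  0 < u -> 0 < T -> 0 <= walk_rate u T w.
Proof.
move=> u0 T0; apply: mulr_ge0; first exact: ltW.
apply: mulr_ge0.
  by rewrite divr_ge0 ?mulr_ge0 ?addr_ge0 // ltW.
exact: killed_srw_pmf_ge0.
Qed.

Lemma walk_rate_le (R : realType) (d : nat) (u T : R) (w : fpath d) :
  0 < u -> 0 < T ->
  walk_rate u T w <= u * (2 * d%:R / (T + 1) *
    (killed_length_pmf T (path_length w) *
       ((2 * d%:R)^-1) ^+ path_length w)).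
Proof.
move=> u0 T0; rewrite /walk_rate /killed_srw_pmf eqxx.
apply: ler_wpM2l; first exact: ltW.
apply: ler_wpM2l; first by rewrite divr_ge0 ?mulr_ge0 ?addr_ge0 // ltW.
apply: ler_wpM2l; first exact: killed_length_pmf_ge0.
rewrite -[X in _ ^+ X]card_ord -prodr_const; apply: ler_prod => i _.
by rewrite /srw_kernel; case: ifP => _; rewrite ?lexx ?andbT ?invr_ge0 ?mulr_ge0.
Qed.

Lemma fri_intensity_set1 (R : realType) (d : nat) (u T : R) (w : fpath d) :
  0 < T -> fri_intensity u T [set w]%classic = (walk_rate u T w)%:E.
Proof.
move=> T0; rewrite /fri_intensity /walk_rate [in RHS]EFinM; congr (_ * _)%E.
have E x : ((2 * d%:R / (T + 1))%:E * killed_srw T x [set w]%classic)%E =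
           (2 * d%:R / (T + 1) * killed_srw_pmf T x w)%:E.
  by rewrite /killed_srw esum_set1 ?EFinM // lee_fin killed_srw_pmf_ge0.
rewrite (eq_esum _
  (b := fun x => (2 * d%:R / (T + 1) * killed_srw_pmf T x w)%:E)); last first.
  by move=> x _; exact: E.
rewrite (esum_mkcond setT)
  (_ : (fun _ => _) = fun x => if x \in [set path_start w]%classic
     then (2 * d%:R / (T + 1) * killed_srw_pmf T x w)%:E else 0%E).
  rewrite -(esum_mkcond [set path_start w]%classic) esum_set1 //.
  rewrite lee_fin mulr_ge0 ?killed_srw_pmf_ge0 //.
  by rewrite divr_ge0 ?mulr_ge0 ?addr_ge0 // ltW.
apply/funext => x; rewrite in_setT; case: ifPn => //.
rewrite notin_setE /= => /eqP xw.
by rewrite /killed_srw_pmf eq_sym (negbTE xw) mulr0.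
Qed.

(** The right-hand side is the value of E[(N+1)^2] for the length N of a killed
    walk. *)
Lemma killed_length_second_moment (R : realType) (T : R) (K : nat) : 0 < T ->
  \sum_(k < K) (k.+1%:R ^+ 2 * killed_length_pmf T k) <= (1 + T) * (1 + 2 * T).
Proof.
move=> T0; have T1 : T + 1 != 0 by rewrite gt_eqF // addr_gt0.
(* [phi n] is E[(n + N + 1)^2], by the lack of memory of N. *)
pose phi (n : nat) : R := n.+1%:R ^+ 2 + 2 * n.+1%:R * T + T + 2 * T ^+ 2.
have E : \sum_(k < K) (k.+1%:R ^+ 2 * killed_length_pmf T k) =
         (1 + T) * (1 + 2 * T) - (T / (T + 1)) ^+ K * phi K.
  elim: K => [|K IH]; first by rewrite big_ord0 /phi expr0; ring.
  rewrite big_ord_recr /= IH /killed_length_pmf /phi [(T / (T + 1)) ^+ K.+1]exprS.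
  rewrite -[K.+2%:R]natr1 -[K.+1%:R]natr1.
  by set Q := _ ^+ K; field.
rewrite E gerBl mulr_ge0 ?exprn_ge0 ?divr_ge0 ?addr_ge0 ?(ltW T0) //.
  by rewrite mulr_ge0 ?(ltW T0) // mulr_ge0.
by rewrite mulr_ge0 // exprn_ge0 // ltW.
Qed.

Lemma mem_sites_le_sum (R : realType) (d : nat) (y : Zd d) (w : fpath d) :
  (y \in sites w)%:R <= \sum_(i < (path_length w).+1) (path_site w i == y)%:R :> R.
Proof.
have [yw|_] := boolP (y \in sites w); last by apply: sumr_ge0.
have iw : (index y (sites w) < (path_length w).+1)%N by rewrite -index_mem in yw.
have site_y : path_site w (Ordinal iw) == y.
  by rewrite [path_site _ _]nth_index ?eqxx.
by rewrite (bigD1 (Ordinal iw)) // site_y lerDl; apply: sumr_ge0.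
Qed.

(** Mean total number of sites of the trajectories through a given site. *)
Lemma sum_walk_rate_through (R : realType) (d : nat) (u T : R) (y : Zd d)
    (X : seq (fpath d)) : (0 < d)%N -> 0 < u -> 0 < T -> uniq X ->
  \sum_(w <- X) ((y \in sites w)%:R * (size (sites w))%:R * walk_rate u T w)
    <= 2 * d%:R * u * (1 + 2 * T).
Proof.
move=> d0 u0 T0 uX.
have dR0 : 2 * d%:R != 0 :> R by rewrite mulf_neq0 // pnatr_eq0 -lt0n.
have T1 : T + 1 != 0 by rewrite gt_eqF // addr_gt0.
(* [g k] bounds the contribution of one path of length [k]; the paths through [y]
   are sorted by their length [k] and by a time [i] at which they are at [y]. *)
pose g k : R := k.+1%:R * (u * (2 * d%:R / (T + 1) *
    (killed_length_pmf T k * ((2 * d%:R)^-1) ^+ k))).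
have g0 k : 0 <= g k.
  apply: mulr_ge0 => //; apply: mulr_ge0; first exact: ltW.
  apply: mulr_ge0; first by rewrite divr_ge0 ?mulr_ge0 ?addr_ge0 // ltW.
  apply: mulr_ge0; first exact: killed_length_pmf_ge0.
  by rewrite exprn_ge0 // invr_ge0 mulr_ge0.
pose K := (\max_(w <- X) path_length w).+1.
apply: (@le_trans _ _ (\sum_(w <- X) \sum_(k < K) \sum_(i < k.+1)
    ((path_length w == k) && (path_site w i == y))%:R * g k)).
  rewrite big_seq [leRHS]big_seq; apply: ler_sum => w wX.
  have wK : (path_length w < K)%N by rewrite ltnS; exact: leq_bigmax_seq.
  rewrite (bigD1 (Ordinal wK)) //= -[leLHS]addr0; apply: lerD; last first.
    by apply: sumr_ge0 => k _; apply: sumr_ge0 => i _; rewrite mulr_ge0.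
  rewrite eqxx -mulr_suml -mulrA; apply: ler_pM => //.
  - by rewrite mulr_ge0 ?walk_rate_ge0.
  - exact: mem_sites_le_sum.
  - by rewrite ler_wpM2l // walk_rate_le.
rewrite exchange_big /=.
apply: (@le_trans _ _ (\sum_(k < K) 2 * d%:R * u / (T + 1) *
    (k.+1%:R ^+ 2 * killed_length_pmf T k))); last first.
  rewrite -mulr_sumr.
  apply: (@le_trans _ _ (2 * d%:R * u / (T + 1) * ((1 + T) * (1 + 2 * T)))).
    rewrite ler_wpM2l ?killed_length_second_moment //.
    by rewrite divr_ge0 ?addr_ge0 ?mulr_ge0 // ltW.
  by rewrite le_eqVlt; apply/orP; left; apply/eqP; field.
apply: ler_sum => k _; rewrite exchange_big /=.
apply: (@le_trans _ _ (\sum_(i < k.+1) (2 * d%:R) ^+ k * g k)).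
  apply: ler_sum => i _; rewrite -mulr_suml ler_wpM2r //.
  rewrite -natr_sum -natrM -natrX ler_nat.
  have ik : (i <= k)%N by rewrite -ltnS.
  apply: leq_trans (count_paths_at _ _ _ _ y uX ik).
  by rewrite -sum1_count [leqRHS]big_mkcond leq_sum // => w _; case: ifP.
rewrite sumr_const card_ord -[_ *+ k.+1]mulr_natr /g exprVn le_eqVlt; apply/orP; left.
apply/eqP; have := expf_neq0 k dR0; set D := _ ^+ k => D0.
by field; rewrite T1.
Qed.

(** * Chains of intersecting trajectories *)

(** The sites reached from [x] by the chain [c]: one goes along the first
    trajectory, which must pass through [x], leaves it at one of its sites [z],
    and goes on from [z] along the rest of the chain. The result is empty if
    [c] is not a chain from [x]. It is a list with repetitions: a site is counted
    once for every choice of the intermediate points [z]. *)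
Fixpoint chain_ends {d : nat} (c : seq (fpath d)) (x : Zd d) : seq (Zd d) :=
  if c is w :: c' then
    if x \in sites w then flatten [seq chain_ends c' z | z <- sites w] else [::]
  else [:: x].

Lemma chain_ends_cons (d : nat) (w : fpath d) (c : seq (fpath d)) (x : Zd d) :
  chain_ends (w :: c) x =
  if x \in sites w then flatten [seq chain_ends c z | z <- sites w] else [::].
Proof. by []. Qed.

Lemma ler_sum_uniq_sub (R : numDomainType) (I : eqType) (s t : seq I)
    (f : I -> R) :
  uniq s -> {subset s <= t} -> (forall i, 0 <= f i) ->
  \sum_(i <- s) f i <= \sum_(i <- t) f i.
Proof.
move=> us st f0; elim: s t us st => [|a s IH] t /=.
  by move=> _ _; rewrite big_nil; apply: sumr_ge0.
move=> /andP[nas us] st.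
have ta : a \in t by apply: st; rewrite inE eqxx.
rewrite big_cons (perm_big _ (perm_to_rem ta)) big_cons /= lerD2l.
apply: IH => // b bs; have : b \in t by apply: st; rewrite inE bs orbT.
rewrite (perm_mem (perm_to_rem ta)) inE => /predU1P[ba|//].
by rewrite ba in bs; rewrite bs in nas.
Qed.

(** If the mean number of sites of the trajectories through any given site is at
    most [beta < 1], then the total weight of the chains from [x] is at most
    [1 / (1 - beta)]. A chain is counted with the multiplicity
    [size (chain_ends c x)], which vanishes when [c] is not a chain from [x] and
    makes the weight multiplicative along the chain. *)
Lemma sum_chain_weight (R : realFieldType) (d : nat) (mu : fpath d -> R)
    (beta : R) :
  (forall w, 0 <= mu w) -> beta < 1 ->
  (forall (X : seq (fpath d)) (y : Zd d), uniq X ->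
    \sum_(w <- X) ((y \in sites w)%:R * (size (sites w))%:R * mu w) <= beta) ->
  forall (C : seq (seq (fpath d))) (x : Zd d), uniq C ->
    \sum_(c <- C) ((size (chain_ends c x))%:R * \prod_(w <- c) mu w)
      <= (1 - beta)^-1.
Proof.
move=> mu0 beta1 Hbeta C x uC; set M := (1 - beta)^-1.
have M0 : 0 <= M by rewrite invr_ge0 subr_ge0 ltW.
pose wt (x : Zd d) c := (size (chain_ends c x))%:R * \prod_(w <- c) mu w.
have wt0 z c : 0 <= wt z c by rewrite mulr_ge0 ?prodr_ge0.
have wtS z w c :
    wt z (w :: c) = (z \in sites w)%:R * mu w * \sum_(v <- sites w) wt v c.
  rewrite /wt big_cons -mulr_suml -natr_sum.
  rewrite chain_ends_cons; case: ifP => _.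
    rewrite size_flatten sumnE /shape -map_comp big_map mul1r.
    by rewrite mulrCA mulrA.
  by rewrite !mul0r.
suff H n : forall (C : seq (seq (fpath d))) (x : Zd d), uniq C ->
    all (fun c => (size c < n)%N) C -> \sum_(c <- C) wt x c <= M.
  apply: (H (\max_(c <- C) size c).+1) => //.
  by apply/allP => c cC; rewrite ltnS; exact: leq_bigmax_seq.
elim: n => [|n IH] {C x uC} [|c0 C0] x uC Cn; rewrite ?big_nil //.
move: uC Cn; set C := c0 :: C0 => uC Cn.
(* A nonempty chain in [C] has its first trajectory in [W] and the rest of it in
   [D], to which the induction hypothesis applies. *)
pose W := undup (pmap ohead C).
pose D := undup [seq behead c | c <- C & c != [::]].
have CWD : {subset C <= [::] :: [seq w :: c | w <- W, c <- D]}.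
  move=> [|w c] cC; rewrite inE //=; apply/allpairsP; exists (w, c).
  split=> //=; rewrite mem_undup.
    by rewrite mem_pmap; apply/mapP; exists (w :: c).
  by apply/mapP; exists (w :: c) => //; rewrite mem_filter.
apply: le_trans (@ler_sum_uniq_sub _ _ _ _ _ uC CWD (wt0 x)) _.
rewrite big_cons big_allpairs_dep {1}/wt big_nil mulr1 /=.
(* The 1 is the weight of the empty chain. *)
have -> : M = 1 + beta * M.
  by rewrite /M; field; rewrite subr_eq0 gt_eqF.
rewrite lerD2l.
apply: (@le_trans _ _ (\sum_(w <- W)
    ((x \in sites w)%:R * (size (sites w))%:R * mu w) * M)); last first.
  by rewrite -mulr_suml ler_wpM2r // Hbeta // undup_uniq.
apply: ler_sum => w _.
rewrite (eq_bigr (fun c => (x \in sites w)%:R * mu w *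
   \sum_(v <- sites w) wt v c)); last by move=> c _; exact: wtS.
rewrite -mulr_sumr [X in X * M]mulrAC -[leRHS]mulrA.
apply: ler_wpM2l; first by rewrite mulr_ge0.
rewrite exchange_big /=.
apply: (@le_trans _ _ (\sum_(v <- sites w) M)).
  apply: ler_sum => v _; apply: IH; first exact: undup_uniq.
  apply/allP => c; rewrite mem_undup => /mapP[c'].
  rewrite mem_filter => /andP[c'0 c'C] ->.
  by move/allP: Cn => /(_ _ c'C); case: c' c'0 {c'C}.
by rewrite big_const_seq count_predT iter_addr_0 mulr_natl.
Qed.

(** A chain can be entered at any of its trajectories. *)
Lemma chain_ends_suffix (d : nat) (a b : seq (fpath d)) (w : fpath d)
    (z x y : Zd d) :
  y \in chain_ends (a ++ w :: b) z -> x \in sites w ->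
  y \in chain_ends (w :: b) x.
Proof.
elim: a z => [|v a IH] z.
  by rewrite cat0s !chain_ends_cons; case: ifP => // _ yw ->.
rewrite cat_cons chain_ends_cons; case: ifP => // _.
by move=> /flatten_mapP[t _ yt] xw; exact: IH yt xw.
Qed.

(** Two open edges with a common end are traversed by intersecting trajectories.
    The trajectories of the chain can be taken distinct: whenever the
    trajectory to be added in front occurs in the chain already, all that
    precedes its occurrence is dropped. *)
Lemma cluster_chain {R : realType} (d : nat)
    (m : {measure set (fpath d) -> \bar R}) (x y : Zd d) :
  cluster m x y -> exists c : seq (fpath d),
    [/\ uniq c, forall w, w \in c -> (0 < m [set w]%classic)%E &
        y \in chain_ends c x].
Proof.
move=> /clos_rt_rt1n_iff; elim=> {x y} [x|x z y xz _ [c [uc mc yc]]].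
  by exists [::]; rewrite mem_seq1 eqxx.
have [_ [w [mw [i iw ei]]]] := xz.
have e_sites (v : Zd d) : v = x \/ v = z -> v \in sites w.
  move=> vxz; have : [set x; z]%classic v by case: vxz => ->; [left|right].
  rewrite ei => -[] ->; rewrite /path_site mem_nth //=.
    by rewrite ltnS ltnW.
have xw : x \in sites w by apply: e_sites; left.
have zw : z \in sites w by apply: e_sites; right.
have [wc|wc] := boolP (w \in c).
  have [a [b ec]] : exists a b, c = a ++ w :: b.
    by case/splitPr: wc => a b; exists a, b.
  exists (w :: b); split.
  - by move: uc; rewrite ec cat_uniq => /and3P[].
  - by move=> v vb; apply: mc; rewrite ec mem_cat vb orbT.
  - by move: yc; rewrite ec => /chain_ends_suffix; apply.
exists (w :: c); split.
- by rewrite /= wc.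
- by move=> v; rewrite inE => /predU1P[->|/mc].
- by rewrite chain_ends_cons xw; apply/flatten_mapP; exists z.
Qed.

(** * Almost sure finiteness of the clusters *)

(** The event that all the trajectories of [c] occur. *)
Definition all_open {R : realType} {d : nat} {Omega : Type}
    (FI : Omega -> {measure set (fpath d) -> \bar R}) (c : seq (fpath d)) :
    set Omega :=
  [set omega | forall w, w \in c -> (0 < FI omega [set w])%E]%classic.

(** The trajectory [w] occurs with probability 1 - exp(-r) <= r, where r is its
    intensity. *)
Lemma prob_occupied_le (R : realType) (d : nat) (u T : R)
    (d' : measure_display) (Omega : measurableType d')
    (P : probability Omega R) (FI : Omega -> {measure set (fpath d) -> \bar R})
    (w : fpath d) :
  0 < u -> 0 < T -> is_fri u T P FI ->
  (P ((fun omega => FI omega [set w]) @^-1` (~` [set 0%E]))%classic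
    <= (walk_rate u T w)%:E)%E.
Proof.
move=> u0 T0 fri.
have mw : measurable [set w]%classic by [].
rewrite -preimage_setC probability_setC; last first.
  rewrite -[X in measurable X]setTI.
  by apply: (ppp_measurable fri mw) => //; exact: emeasurable_set1.
have := ppp_poisson fri mw; rewrite fri_intensity_set1 // => /(_ 0%N).
rewrite expr0 fact0 divr1 mul1r => ->.
rewrite -EFinB lee_fin.
have := expR_ge1Dx (- walk_rate u T w); lra.
Qed.

Lemma all_openE (R : realType) (d : nat) (Omega : Type)
    (FI : Omega -> {measure set (fpath d) -> \bar R}) (c : seq (fpath d))
    (w0 : fpath d) :
  all_open FI c = (\bigcap_(i in [set: 'I_(size c)])
    ((fun omega => FI omega [set nth w0 c i]) @^-1` (~` [set 0%E])))%classic.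
Proof.
apply/seteqP; split=> omega /= H.
  move=> i _ /=; have := H _ (mem_nth w0 (ltn_ord i)).
  by rewrite lt0e => /andP[/eqP].
move=> w wc; rewrite -index_mem in wc.
have /= := H (Ordinal wc) I; rewrite nth_index -?index_mem // => /eqP w1.
by rewrite lt0e w1 measure_ge0.
Qed.

Lemma measurable_all_open (R : realType) (d : nat) (u T : R)
    (d' : measure_display) (Omega : measurableType d')
    (P : probability Omega R) (FI : Omega -> {measure set (fpath d) -> \bar R})
    (c : seq (fpath d)) :
  is_fri u T P FI -> measurable (all_open FI c).
Proof.
move=> fri; rewrite (all_openE _ _ _ _ _ point).
apply: fin_bigcap_measurable => // i _; rewrite -[X in measurable X]setTI.
have mw : measurable [set nth point c i]%classic by [].
apply: (ppp_measurable fri mw) => //.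
by apply: measurableC; exact: emeasurable_set1.
Qed.

Lemma prob_all_open_le (R : realType) (d : nat) (u T : R)
    (d' : measure_display) (Omega : measurableType d')
    (P : probability Omega R) (FI : Omega -> {measure set (fpath d) -> \bar R})
    (c : seq (fpath d)) :
  0 < u -> 0 < T -> is_fri u T P FI -> uniq c ->
  (P (all_open FI c) <= (\prod_(w <- c) walk_rate u T w)%:E)%E.
Proof.
move=> u0 T0 fri uc; rewrite (all_openE _ _ _ _ _ point).
have tc : trivIset [set: 'I_(size c)] (fun i => [set nth point c i]%classic).
  move=> i j _ _ [w [/= -> /eqP]].
  by rewrite nth_uniq // => /eqP/val_inj.
have mc (i : 'I_(size c)) : measurable [set nth point c i]%classic by [].
have mB (i : 'I_(size c)) : measurable (~` [set 0%E : \bar R])%classic.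
  by apply: measurableC; exact: emeasurable_set1.
rewrite (ppp_independent fri mc tc mB) (big_nth point) big_mkord -prodEFin.
suff /andP[] : (0 <= \prod_(i < size c) P
    ((fun omega => FI omega [set nth point c i]) @^-1` (~` [set 0%E]))%classic
    <= \prod_(i < size c) (walk_rate u T (nth point c i))%:E)%E by [].
elim/big_ind2: _ => [|a b a' b' /andP[a0 ab] /andP[a'0 ab']|i _].
- by rewrite lee_fin ler01 lexx.
- by rewrite mule_ge0 // lee_pmul.
- by rewrite measure_ge0 (@prob_occupied_le _ _ _ _ _ _ P).
Qed.

Lemma infinite_cluster_negligible (R : realType) (d : nat) (u T : R)
    (d' : measure_display) (Omega : measurableType d')
    (P : probability Omega R) (FI : Omega -> {measure set (fpath d) -> \bar R})
    (x : Zd d) :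
  (0 < d)%N -> 0 < u -> 0 < T -> 2 * d%:R * u * (1 + 2 * T) < 1 ->
  is_fri u T P FI ->
  P.-negligible [set omega | infinite_set (cluster (FI omega) x)]%classic.
Proof.
move=> d0 u0 T0 beta1 fri.
pose wt c : R := (size (chain_ends c x))%:R * \prod_(w <- c) walk_rate u T w.
have wt0 c : 0 <= wt c.
  by rewrite mulr_ge0 // prodr_ge0 // => w _; exact: walk_rate_ge0.
(* The events of the Borel-Cantelli lemma are indexed by the codes of the finite
   sequences of trajectories; the codes of nothing give empty events. *)
pose F n : set Omega := if pickle_inv n is Some c then
  (if uniq c && (chain_ends c x != [::]) then all_open FI c else set0) else set0.
have mF n : measurable (F n).
  rewrite /F; case: pickle_inv => [c|] //; case: ifP => // _.
  exact: measurable_all_open fri.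
have PF n : (P (F n) <= (oapp wt 0 (pickle_inv n))%:E)%E.
  rewrite /F; case: pickle_inv => [c|] /=; last by rewrite measure0.
  case: ifP => [/andP[uc ec]|_]; last by rewrite measure0 lee_fin.
  apply: le_trans (prob_all_open_le _ _ _ _ _ _ _ _ _ u0 T0 fri uc) _.
  rewrite lee_fin ler_peMl ?ler1n ?lt0n ?size_eq0 // prodr_ge0 // => w _.
  exact: walk_rate_ge0.
have sumF : (\sum_(n <oo) P (F n) < +oo)%E.
  apply: (@le_lt_trans _ _ ((1 - 2 * d%:R * u * (1 + 2 * T))^-1)%:E).
    2: exact: ltry.
  apply: lime_le; first by apply: is_cvg_nneseries => n _ _; exact: measure_ge0.
  apply: nearW => N; apply: (@le_trans _ _ (\sum_(0 <= n < N)
      (oapp wt 0 (pickle_inv n))%:E)%E).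
    by apply: lee_sum => n _; exact: PF.
  rewrite sumEFin lee_fin -big_pmap.
  apply: sum_chain_weight => //.
  - by move=> w; exact: walk_rate_ge0.
  - by move=> X y uX; exact: sum_walk_rate_through.
  - by apply: (pmap_uniq (@pickle_invK _)); exact: iota_uniq.
exists (lim_sup_set F); split.
- apply: bigcap_measurable; first by exists 0%N.
  by move=> n _; exact: bigcup_measurable.
- exact: lim_sup_set_cvg0.
move=> omega /=; apply: contra_notP => notF.
have [n nF] : exists n, forall j, (n <= j)%N -> ~ F j omega.
  apply/not_existsP => H; apply: notF => n _.
  have /existsNP[j /not_implyP[nj /notP Fj]] := H n.
  by exists j.
pose E := [set` flatten [seq oapp (chain_ends^~ x) [::] (pickle_inv j)
  | j <- iota 0 n]]%classic.
apply: (@sub_finite_set _ _ E); last exact: finite_seq.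
move=> y /cluster_chain[c [uc mc yc]] /=.
have Fc : F (pickle c) omega.
  by rewrite /F pickleK_inv uc; case: (chain_ends c x) yc.
apply/flatten_mapP; exists (pickle c); last by rewrite pickleK_inv.
rewrite mem_iota leq0n add0n ltnNge /=; apply/negP => /nF; exact.
Qed.

(** 2du(1 + 2T) bounds the mean offspring in the exploration of a cluster. *)
Lemma as_no_percolation_subcritical (R : realType) (d : nat) (u T : R) :
  (0 < d)%N -> 0 < u -> 0 < T -> 2 * d%:R * u * (1 + 2 * T) < 1 ->
  as_no_percolation d u T.
Proof.
move=> d0 u0 T0 beta1 d' Omega P FI fri.
pose G n : set Omega := if pickle_inv n is Some x then
  [set omega | infinite_set (cluster (FI omega) x)]%classic else set0.
apply: (@negligibleS _ _ _ _ (\bigcup_n G n)%classic).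
  move=> omega /= /contrapT[x Hx]; exists (pickle x) => //.
  by rewrite /G pickleK_inv.
apply: negligible_bigcup => n; rewrite /G; case: pickle_inv => [x|].
  exact: infinite_cluster_negligible fri.
exact: negligible_set0.
Qed.

Theorem theorem3 (R : realType) (d : nat) (delta : R) :
  (3 <= d)%N -> 0 < delta ->
  exists U0 C1 : R, [/\ 0 < U0, U0 < 1, 0 < C1 &
    forall u : R, 0 < u -> u <= U0 ->
      ((C1 * u `^ (- (1 / (d%:R - 1)) + delta))%:E <= Tc_minus d u)%E].
Proof.
move=> d3 delta0; have d0 : (0 < d)%N by apply: leq_trans d3.
have dR : 3 <= d%:R :> R by rewrite ler_nat.
exists (16 * d%:R)^-1, (16 * d%:R)^-1; split.
- by rewrite invr_gt0; lra.
- by rewrite invf_lt1; lra.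
- by rewrite invr_gt0; lra.
move=> u u0 uU; set a := - _ + delta.
have c0 : 0 < (16 * d%:R)^-1 :> R by rewrite invr_gt0; lra.
have c1 : (16 * d%:R)^-1 <= 1 :> R by rewrite invf_le1; lra.
(* This is where -1/(d-1) + delta >= -1 is used. *)
have ua : u * u `^ a <= 1.
  have a1 : 0 <= 1 + a.
    have : 1 / (d%:R - 1) <= 1 :> R by rewrite ler_pdivrMr; lra.
    by rewrite /a; lra.
  rewrite -{1}[u]powRr1 ?(ltW u0) // -powRD; last by rewrite (gt_eqF u0) implybT.
  by rewrite -[X in _ <= X](powRr0 u) ger_powR // u0 (le_trans uU).
apply: ereal_sup_ubound; exists ((16 * d%:R)^-1 * u `^ a) => //=.
split; first by rewrite mulr_gt0 // powR_gt0.
move=> T T0 TT; apply: as_no_percolation_subcritical => //.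
have uT : u * T <= (16 * d%:R)^-1.
  apply: (@le_trans _ _ (u * ((16 * d%:R)^-1 * u `^ a))).
    by rewrite ler_wpM2l // ltW.
  by rewrite mulrCA ler_piMr // ltW.
have dc : d%:R * (16 * d%:R)^-1 = 16^-1 :> R by field; lra.
have du : d%:R * u <= 16^-1 by rewrite -dc ler_wpM2l.
have duT : d%:R * (u * T) <= 16^-1 by rewrite -dc ler_wpM2l.
lra.
Qed.
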